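(* For any integer $n\ge 2$ and any integer $m\ge 0$ the following holds: (i) $\vartheta\text{-rank}(C_{2n+1}\oplus\overline{K_m})=1$ if and only if $m\le 4+\frac{4}{n-1}$. (ii) $\vartheta\text{-rank}(\overline{C_{2n+1}}\oplus\overline{K_m})=1$ if and only if $m\le 8$.
   Context: For a graph $G$ with vertex set $[N]$, $\alpha(G)$ is the maximum cardinality of a stable (independent) set, $A_G$ is the adjacency matrix, $I$ the identity and $J$ the all-ones matrix. For $r\in\mathbb N=\{0,1,\dots\}$, $\mathcal K_N^{(r)}$ is the set of real symmetric $N\times N$ matrices $M$ such that $(\sum_{i=1}^N x_i^2)^r\sum_{i,j=1}^N M_{ij}x_i^2x_j^2$ is a sum of squares of real polynomials. The $\vartheta$-rank of $G$, $\vartheta\text{-rank}(G)$, is the smallest $r\in\mathbb N$ with $\alpha(G)(A_G+I)-J\in\mathcal K_N^{(r)}$, and $\infty$ if no such $r$ exists. $C_{2n+1}$ is the cycle on $2n+1$ nodes, $\overline{C_{2n+1}}$ its complement graph, $\oplus$ denotes disjoint union of graphs and $\overline{K_m}$ is the graph consisting of $m$ isolated nodes. *)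

(* Defs.v *)
From HB Require Import structures.
From mathcomp Require Import all_boot all_order all_algebra.
From mathcomp Require Import boolp reals.
From mathcomp Require Import mpoly.

Set Implicit Arguments.
Unset Strict Implicit.
Unset Printing Implicit Defensive.

Import Order.TTheory GRing.Theory Num.Theory.
Local Open Scope ring_scope.

(* [symmetric] alone would denote the symmetric polynomials of mpoly. *)
Record graph (N : nat) := Graph {
  adj :> rel 'I_N;
  adj_sym : ssrbool.symmetric adj;
  adj_irr : irreflexive adj
}.

Definition edgeless_adj (N : nat) : rel 'I_N := fun _ _ => false.

Lemma edgeless_sym N : ssrbool.symmetric (@edgeless_adj N).
Proof. by []. Qed.

Lemma edgeless_irr N : irreflexive (@edgeless_adj N).
Proof. by []. Qed.

Definition edgeless (N : nat) : graph N :=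
  Graph (@edgeless_sym N) (@edgeless_irr N).

(* [ordS] is the cyclic successor i |-> i + 1 mod N.  The condition i != j only
   matters for N = 1; this is the usual cycle as soon as N >= 3. *)
Definition cycle_adj (N : nat) : rel 'I_N :=
  fun i j => (i != j) && ((j == ordS i) || (i == ordS j)).

Lemma cycle_sym N : ssrbool.symmetric (@cycle_adj N).
Proof. by move=> i j; rewrite /cycle_adj eq_sym orbC. Qed.

Lemma cycle_irr N : irreflexive (@cycle_adj N).
Proof. by move=> i; rewrite /cycle_adj eqxx. Qed.

Definition cycle_graph (N : nat) : graph N :=
  Graph (@cycle_sym N) (@cycle_irr N).

Definition compl_adj (N : nat) (G : graph N) : rel 'I_N :=
  fun i j => (i != j) && ~~ G i j.

Lemma compl_sym N (G : graph N) : ssrbool.symmetric (compl_adj G).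
Proof. by move=> i j; rewrite /compl_adj eq_sym (adj_sym G). Qed.

Lemma compl_irr N (G : graph N) : irreflexive (compl_adj G).
Proof. by move=> i; rewrite /compl_adj eqxx. Qed.

Definition compl_graph (N : nat) (G : graph N) : graph N :=
  Graph (compl_sym G) (compl_irr G).

Definition dunion_adj (N1 N2 : nat) (G : graph N1) (H : graph N2) :
    rel 'I_(N1 + N2) :=
  fun i j => match split i, split j with
             | inl a, inl b => G a b
             | inr a, inr b => H a b
             | _, _ => false
             end.

Lemma dunion_sym N1 N2 (G : graph N1) (H : graph N2) :
  ssrbool.symmetric (dunion_adj G H).
Proof.
move=> i j; rewrite /dunion_adj.
by case: (split i) => a; case: (split j) => b //; rewrite adj_sym.
Qed.

Lemma dunion_irr N1 N2 (G : graph N1) (H : graph N2) :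
  irreflexive (dunion_adj G H).
Proof. by move=> i; rewrite /dunion_adj; case: (split i) => a; rewrite adj_irr. Qed.

Definition dunion (N1 N2 : nat) (G : graph N1) (H : graph N2) :
    graph (N1 + N2) :=
  Graph (dunion_sym G H) (dunion_irr G H).

Definition stable (N : nat) (G : graph N) (S : {set 'I_N}) : bool :=
  [forall i in S, forall j in S, ~~ G i j].

Definition alpha (N : nat) (G : graph N) : nat :=
  \max_(S : {set 'I_N} | stable G S) #|S|.

Definition adjmx (R : realType) (N : nat) (G : graph N) : 'M[R]_N :=
  \matrix_(i, j) (G i j)%:R.

Definition sos (R : realType) (N : nat) (p : {mpoly R[N]}) : Prop :=
  exists s : seq {mpoly R[N]}, p = \sum_(q <- s) q ^+ 2.

Definition in_K (R : realType) (N r : nat) (M : 'M[R]_N) : Prop :=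
  M^T = M /\
  sos ((\sum_(i < N) ('X_i : {mpoly R[N]}) ^+ 2) ^+ r
       * \sum_(i < N) \sum_(j < N) M i j *: ('X_i ^+ 2 * 'X_j ^+ 2)).

Definition stabmx (R : realType) (N : nat) (G : graph N) : 'M[R]_N :=
  (alpha G)%:R *: (adjmx R G + 1%:M) - const_mx 1.

(* None stands for infinity.  The value depends on R only
   through the choice of a model of the real numbers. *)
Definition theta_rank (R : realType) (N : nat) (G : graph N) : option nat :=
  match pselect (exists r, `[< in_K r (stabmx R G) >]) with
  | left H => Some (ex_minn H)
  | right _ => None
  end.

(* Main.v *)
Require Import Defs.
From HB Require Import structures.
From mathcomp Require Import all_boot all_order all_algebra.
From mathcomp Require Import reals.
From mathcomp Require Import boolp mpoly zify ring lra.

(* Let H be the cycle or its complement, a = alpha(H), and write x_i for the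
   squared variables of H and y_w for those of the m isolated nodes; s, t are
   their sums, h_i is the sum of x over the closed neighbourhood of i and
   d_i = a h_i - s.  Both bounds on m read m (a - 1) <= 4 a.

   Certificate: up to sums of squares multiplied by squares of variables, the
   polynomial of order 1 reduces to
     4 a s (sum_i x_i d_i) - m (sum_i x_i d_i^2).
   For m (a - 1) = 4 a this is a positive multiple of
     sum_i x_i r_i ((a - 1) h_i - r_i),  r_i = s - h_i,
   which is handled by covering the non-neighbours of each i by a - 1 cliques;
   a smaller m only adds a multiple of sum_i x_i d_i^2.

   Obstruction: set every y_w to 1.  The summands q of a sum-of-squares certificate
   of order at most 1 have degree at most 3 and vanish at every signed
   indicator of a maximum stable set.  Averaging over the signs yields a linear
   relation between the constant and the x_j^2 coefficients of q for each such
   set; these relations force a [x_i^2]q = - [1]q for every i.  On a coordinate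
   axis this is incompatible with order 0, and by Cauchy-Schwarz incompatible
   with order 1 unless m (a - 1) <= 4 a. *)

Set Implicit Arguments.
Unset Strict Implicit.
Unset Printing Implicit Defensive.

Import Order.TTheory GRing.Theory Num.Theory.
Local Open Scope ring_scope.

(** * Stable sets and clique covers *)

Definition closed_nbr (N : nat) (H : graph N) : rel 'I_N :=
  fun i j => (i == j) || H i j.

(** The cover is encoded as a colouring: only the values of [c i] on non-neighbours of [i] are
    constrained. It is applied with [k] equal to the stability number minus one, and serves both to
    bound that number and to build the certificate. *)
Definition nonneighbours_clique_cover (N k : nat) (H : graph N)
    (c : 'I_N -> 'I_N -> 'I_k) : Prop :=
  forall i j l, ~~ closed_nbr H i j -> ~~ closed_nbr H i l ->
    c i j = c i l -> closed_nbr H j l.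

(** For [a > 0] this says that the indicator vectors of the stable sets of size [a] span the whole
    space. *)
Definition stable_sets_determine (R : realType) (N : nat) (H : graph N)
    (a : nat) : Prop :=
  forall (u : 'I_N -> R) (u0 : R),
    (forall S, stable H S -> #|S| = a -> \sum_(j in S) u j = u0) ->
  forall i, a%:R * u i = u0.

Lemma closed_nbrC N (H : graph N) i j : closed_nbr H i j = closed_nbr H j i.
Proof. by rewrite /closed_nbr eq_sym adj_sym. Qed.

Lemma stableP N (H : graph N) (S : {set 'I_N}) :
  reflect (forall i j, i \in S -> j \in S -> ~~ H i j) (stable H S).
Proof.
apply: (iffP forall_inP) => [h i j iS jS|h i iS].
  by have /forall_inP := h i iS; apply.
by apply/forall_inP => j jS; apply: h.
Qed.

(** Fix [i] in [S]. The other elements of [S] are non-neighbours of [i] and pairwise non-adjacent,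
    so [c i] puts them into distinct cliques. *)
Lemma stable_card_le N k (H : graph N) (c : 'I_N -> 'I_N -> 'I_k) S :
  nonneighbours_clique_cover H c -> stable H S -> (#|S| <= k.+1)%N.
Proof.
move=> cov /stableP st.
have [->|[i iS]] := set_0Vmem S; first by rewrite cards0.
rewrite (cardsD1 i) iS ltnS.
have nonnbr j : j \in S :\ i -> ~~ closed_nbr H i j.
  rewrite in_setD1 => /andP[ji jS].
  by rewrite /closed_nbr negb_or eq_sym ji st.
have inj : {in S :\ i &, injective (c i)}.
  move=> j l jS lS ejl; have := cov _ _ _ (nonnbr _ jS) (nonnbr _ lS) ejl.
  move: jS lS; rewrite !in_setD1 => /andP[_ jS] /andP[_ lS].
  by rewrite /closed_nbr (negbTE (st _ _ jS lS)) orbF => /eqP.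
rewrite -(card_in_imset inj) -[X in (_ <= X)%N]card_ord.
exact: max_card.
Qed.

Lemma alpha_eq N k (H : graph N) (c : 'I_N -> 'I_N -> 'I_k) S :
  nonneighbours_clique_cover H c -> stable H S -> #|S| = k.+1 ->
  alpha H = k.+1.
Proof.
move=> cov stS cS; apply/eqP; rewrite eqn_leq; apply/andP; split.
  by apply/bigmax_leqP => T /(stable_card_le cov).
by rewrite -cS; apply: leq_bigmax_cond.
Qed.

(** * Disjoint union with isolated nodes *)

Lemma sum_dunion (V : nmodType) N m (F : 'I_(N + m) -> V)
    (S : {set 'I_(N + m)}) :
  \sum_(i in S) F i = \sum_(i | lshift m i \in S) F (lshift m i) +
                      \sum_(w | rshift N w \in S) F (rshift N w).
Proof. by rewrite big_mkcond big_split_ord /= -!big_mkcond. Qed.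

Lemma split_lshift N m (i : 'I_N) : split (lshift m i) = inl i.
Proof. exact: (unsplitK (inl i)). Qed.

Lemma split_rshift N m (w : 'I_m) : split (rshift N w) = inr w.
Proof. exact: (unsplitK (inr w)). Qed.

Lemma dunion_ll N m (H : graph N) (K : graph m) i j :
  dunion H K (lshift m i) (lshift m j) = H i j.
Proof. by rewrite /= /dunion_adj !split_lshift. Qed.

Lemma dunion_lr N m (H : graph N) (K : graph m) i w :
  dunion H K (lshift m i) (rshift N w) = false.
Proof. by rewrite /= /dunion_adj split_lshift split_rshift. Qed.

Lemma dunion_rl N m (H : graph N) (K : graph m) i w :
  dunion H K (rshift N w) (lshift m i) = false.
Proof. by rewrite /= /dunion_adj split_lshift split_rshift. Qed.

Lemma dunion_rr N m (H : graph N) (K : graph m) v w :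
  dunion H K (rshift N v) (rshift N w) = K v w.
Proof. by rewrite /= /dunion_adj !split_rshift. Qed.

Lemma alpha_dunion_edgeless N m (H : graph N) :
  alpha (dunion H (edgeless m)) = (alpha H + m)%N.
Proof.
apply/eqP; rewrite eqn_leq; apply/andP; split.
  apply/bigmax_leqP => S /stableP st.
  rewrite -sum1_card sum_dunion !sum1_card leq_add //; last first.
    by rewrite -[X in (_ <= X)%N]card_ord max_card.
  pose T := [set i | lshift m i \in S].
  have stT : stable H T.
    apply/stableP => i j; rewrite !inE => iS jS.
    by rewrite -(dunion_ll H (edgeless m)) st.
  by apply: leq_trans (leq_bigmax_cond _ stT); rewrite cardsE.
have [S stS ->] : exists2 S, stable H S & alpha H = #|S|.
  have st0 : stable H set0 by apply/stableP => i j; rewrite inE.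
  by rewrite /alpha (bigop.bigmax_eq_arg set0) //; case: arg_maxnP => // S; exists S.
pose T : {set 'I_(N + m)} :=
  [set i | match split i with inl j => j \in S | inr _ => true end].
have stT : stable (dunion H (edgeless m)) T.
  apply/stableP => i j; rewrite -(splitK i) -(splitK j) !inE.
  case: (split i) => i'; case: (split j) => j' /=;
    rewrite ?/dunion_adj ?split_lshift ?split_rshift //.
  by move=> iS jS; apply: (stableP _ _ stS).
apply: leq_trans (leq_bigmax_cond _ stT).
rewrite -[X in (_ <= X)%N]sum1_card sum_dunion !sum1_card leq_add //.
  apply/subset_leq_card/subsetP => i iS.
  by rewrite -[_ \in _]/(lshift m i \in T) inE split_lshift.
rewrite -[X in (X <= _)%N](card_ord m).
apply/subset_leq_card/subsetP => i _.
by rewrite -[_ \in _]/(rshift N i \in T) inE split_rshift.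
Qed.


(** * Cycle adjacency as congruences between naturals *)

Lemma cycle_graphE p (a b : nat) : (0 < p)%N ->
  cycle_graph p.+1 (inZp a) (inZp b) =
  (b == a.+1 %[mod p.+1]) || (a == b.+1 %[mod p.+1]).
Proof.
move=> p0; have modS t : ((t %% p.+1).+1 = t.+1 %[mod p.+1])%N.
  by rewrite -[in LHS]addn1 modnDml addn1.
(* For [p > 0] a residue differs from its successor, so either congruence already forces distinct
   vertices. *)
have succ_neq t : (t == t.+1 %[mod p.+1])%N = false.
  by rewrite -{1}[t]addn0 -[t.+1]addn1 eqn_modDl mod0n modn_small.
rewrite /= /cycle_adj -!val_eqE /= !modS.
have [e|//] := eqVneq (a %% p.+1)%N (b %% p.+1)%N.
by rewrite -[in LHS]e -modS -e modS succ_neq -modS e modS succ_neq.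
Qed.

Lemma inZp_subK p (i j : 'I_p.+1) :
  exists2 d, (d <= p)%N & j = inZp (i + d).
Proof.
exists ((j + p.+1 - i) %% p.+1)%N; first by rewrite -ltnS ltn_pmod.
apply: val_inj => /=; rewrite modnDmr subnKC; last by have := ltn_ord i; lia.
by rewrite modnDr modn_small.
Qed.

(** * Odd cycles and their complements *)

Lemma closed_nbr_cycle p (a b : nat) : (0 < p)%N ->
  closed_nbr (cycle_graph p.+1) (inZp a) (inZp b) =
  [|| a == b %[mod p.+1], b == a.+1 %[mod p.+1] | a == b.+1 %[mod p.+1]].
Proof. by move=> p0; rewrite /closed_nbr cycle_graphE // -val_eqE. Qed.

(** The offsets 0, 1 and [p] give the closed neighbourhood of [i]; the offsets left over run along a
    path. *)
Lemma nonneighbour_cycle p (i j : 'I_p.+1) : (0 < p)%N ->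
  ~~ closed_nbr (cycle_graph p.+1) i j ->
  exists2 d, (1 < d < p)%N & j = inZp (i + d).
Proof.
move=> p0; have [d dp ->] := inZp_subK i j.
rewrite -{1}[i]valZpK closed_nbr_cycle // !negb_or => /and3P[h0 h1 h2].
exists d => //; apply/andP; split.
  case: d h0 h1 {dp h2} => [|[|d]] //; first by rewrite addn0 eqxx.
  by rewrite addn1 eqxx.
rewrite ltn_neqAle dp andbT; apply: contra h2 => /eqP->.
by rewrite -addnS modnDr.
Qed.

(** Offsets of [j] ahead of [i] are grouped as {2,3}, {4,5}, ..., {2k+2,2k+3}. The modulus is added
    first so that the natural subtraction does not truncate. *)
Definition cycle_pairing k (i j : 'I_(2 * k.+2).+1) : 'I_k.+1 :=
  inord ((j + (2 * k.+2).+1 - i) %% (2 * k.+2).+1)./2.-1%N.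

Lemma cycle_pairingE k (i : 'I_(2 * k.+2).+1) d : (1 < d < 2 * k.+2)%N ->
  cycle_pairing i (inZp (i + d)) = d./2.-1 :> nat.
Proof.
move=> hd; rewrite /cycle_pairing.
have -> : (((inZp (i + d) : 'I_(2 * k.+2).+1) + (2 * k.+2).+1 - i)
    %% (2 * k.+2).+1 = d)%N.
  have hi := ltn_ord i.
  apply/eqP; rewrite -[X in _ == X](@modn_small _ (2 * k.+2).+1); last by lia.
  rewrite -(eqn_modDr i) subnK; last by lia.
  by rewrite modnDr /= modn_mod addnC.
by rewrite inordK //; lia.
Qed.

(* Minus a closed neighbourhood, the cycle is a path; match it up edge by edge. *)
Lemma cycle_clique_cover k :
  nonneighbours_clique_cover (cycle_graph (2 * k.+2).+1) (@cycle_pairing k).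
Proof.
move=> i j l /nonneighbour_cycle[]// d hd -> /nonneighbour_cycle[]// e he ->.
move/(congr1 val); rewrite /= !cycle_pairingE // => eq_half.
rewrite closed_nbr_cycle //.
have [->|[->|->]] : d = e \/ e = d.+1 \/ d = e.+1 by lia.
- by rewrite eqxx.
- by rewrite addnS eqxx orbT.
- by rewrite addnS eqxx !orbT.
Qed.

Lemma nonneighbour_co_cycle p (i j : 'I_p.+1) :
  ~~ closed_nbr (compl_graph (cycle_graph p.+1)) i j = cycle_graph p.+1 i j.
Proof.
rewrite /closed_nbr /= /compl_adj /= /cycle_adj.
by case: (i == j) => //=; rewrite negbK.
Qed.

Lemma neighbour_cycle p (i j : 'I_p.+1) : (0 < p)%N ->
  cycle_graph p.+1 i j -> j = inZp (i + 1) \/ j = inZp (i + p).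
Proof.
move=> p0; have [d dp ->] := inZp_subK i j.
rewrite -{1}[i]valZpK cycle_graphE // => /orP[].
  by rewrite -[i.+1]addn1 eqn_modDl => /eqP e; left; apply/val_inj; rewrite /= -modnDmr e modnDmr.
rewrite -addnS -{1}[nat_of_ord i]addn0 eqn_modDl mod0n => /eqP e.
right; case: (ltngtP d p) dp e => // [dp _|-> //].
by rewrite modn_small.
Qed.

(** The non-neighbours of [i] in the complement are its two cycle neighbours. These are not adjacent
    on a cycle of length at least 5, so they form a single clique of the complement. *)
Lemma co_cycle_clique_cover k :
  nonneighbours_clique_cover (compl_graph (cycle_graph (2 * k.+2).+1))
    (fun _ _ => ord0 : 'I_1).
Proof.
move=> i j l; rewrite !nonneighbour_co_cycle => ij il _.
apply/negPn; rewrite nonneighbour_co_cycle.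
case/neighbour_cycle: ij => // ->; case/neighbour_cycle: il => // ->;
  rewrite cycle_graphE // -!addnS !eqn_modDl ?modnn ?modn_small; lia.
Qed.

(** * Maximum stable sets and the space they span *)

Lemma span_shift (R : realType) p (U : nat -> R) :
  (forall t, U (t + p.+1)%N = U t) -> (forall t, U (t + p)%N = U t) ->
  forall t, U t = U 0%N.
Proof.
move=> per sh t; elim: t => // t IH.
by rewrite -sh addSnnS per.
Qed.

(** Every second vertex is taken from [b] on; the last offset is 2k+2, two short of the neighbour of
    [b] at offset 2k+4. *)
Lemma cycle_stable_set k b (S := [set inZp (b + 2 * t) | t : 'I_k.+2]
    : {set 'I_(2 * k.+2).+1}) :
  stable (cycle_graph (2 * k.+2).+1) S /\
  injective (fun t : 'I_k.+2 => inZp (b + 2 * t) : 'I_(2 * k.+2).+1).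
Proof.
split.
  apply/stableP => i j /imsetP[t _ ->] /imsetP[s _ ->].
  have ht := ltn_ord t; have hs := ltn_ord s.
  rewrite cycle_graphE // -!addnS !eqn_modDl !modn_small; lia.
move=> t s /(congr1 val) /= /eqP; rewrite eqn_modDl.
have ht := ltn_ord t; have hs := ltn_ord s.
by rewrite !modn_small; try lia; move=> /eqP e; apply/val_inj => /=; lia.
Qed.

(** The alternating sets starting at [t] and [t + 2] share all but one vertex each. Comparing their
    sums gives [U] the period 2k+4 besides 2k+5, hence period one. *)
Lemma cycle_stable_determine (R : realType) k :
  @stable_sets_determine R _ (cycle_graph (2 * k.+2).+1) k.+2.
Proof.
move=> u u0 hu i.
pose U t := u (inZp t).
have sumU b : \sum_(t < k.+2) U (b + 2 * t)%N = u0.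
  have [st inj] := cycle_stable_set k b.
  rewrite -(hu _ st) ?card_imset ?card_ord // big_imset //=.
  by move=> t s _ _; apply: inj.
have per t : U (t + (2 * k.+2).+1)%N = U t.
  by congr u; apply/val_inj; rewrite /= modnDr.
have sh t : U (t + (2 * k.+2))%N = U t.
  have := sumU t; rewrite -(sumU (t + 2)%N) big_ord_recl [RHS]big_ord_recr /=.
  rewrite addn0 addrC; under eq_bigr => s _ do rewrite /bump add1n mulnS addnA.
  by move/addIr => ->; congr U; lia.
have cst := span_shift per sh.
rewrite -(sumU 0%N) (eq_bigr (fun=> u i)) ?sumr_const ?card_ord ?mulr_natl //.
by move=> t _; rewrite cst -[i]valZpK -/(U i) cst.
Qed.

Lemma co_cycle_stable_set p b : (1 < p)%N -> let S := [set inZp b; inZp b.+1] in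
  stable (compl_graph (cycle_graph p.+1)) S /\ inZp b != inZp b.+1 :> 'I_p.+1.
Proof.
move=> p1 S; have adjb : cycle_graph p.+1 (inZp b) (inZp b.+1).
  by rewrite cycle_graphE ?eqxx //; lia.
split; last by apply: contraTneq adjb => ->; rewrite adj_irr.
apply/stableP => i j /set2P[]-> /set2P[]->; rewrite ?adj_irr //=.
  by rewrite /compl_adj adjb andbF.
by rewrite /compl_adj adj_sym adjb andbF.
Qed.

(** Edges of the cycle are stable in the complement, so [U b + U b.+1] is constant and [U] has
    period 2. Since the length is odd, period one follows. *)
Lemma co_cycle_stable_determine (R : realType) k :
  @stable_sets_determine R _ (compl_graph (cycle_graph (2 * k.+2).+1)) 2.
Proof.
move=> u u0 hu i.
pose U t := u (inZp t).
have sumU b : U b + U b.+1 = u0.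
  have [//|st neq] := @co_cycle_stable_set (2 * k.+2) b.
  by rewrite -(hu _ st) ?cards2 ?neq // big_setU1 ?big_set1 // inE.
have per t : U (t + (2 * k.+2).+1)%N = U t.
  by congr u; apply/val_inj; rewrite /= modnDr.
have sh2 t : U t.+2 = U t.
  by apply: (addIr (U t.+1)); rewrite addrC sumU addrC [RHS]addrC sumU.
have sh t : U (t + (2 * k.+2))%N = U t.
  elim: k.+2 => [|l IH]; first by rewrite muln0 addn0.
  by rewrite mulnS addnCA add2n sh2 IH.
have cst := span_shift per sh.
by rewrite -(sumU 0%N) !cst -[i]valZpK -/(U i) cst mulr_natl mulr2n.
Qed.

Lemma alpha_cycle k : alpha (cycle_graph (2 * k.+2).+1) = k.+2.
Proof.
have [st inj] := cycle_stable_set k 0.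
apply: (alpha_eq (@cycle_clique_cover k) st).
by rewrite card_imset // card_ord.
Qed.

Lemma alpha_co_cycle k : alpha (compl_graph (cycle_graph (2 * k.+2).+1)) = 2%N.
Proof.
have [//|st neq] := @co_cycle_stable_set (2 * k.+2) 0.
apply: (alpha_eq (@co_cycle_clique_cover k) st).
by rewrite cards2 neq.
Qed.

(** * Sums of squares *)

Section SumsOfSquares.
Variables (R : realType) (N : nat).
Implicit Types p q : {mpoly R[N]}.

Lemma sos0 : sos (0 : {mpoly R[N]}).
Proof. by exists [::]; rewrite big_nil. Qed.

Lemma sos_sqr q : sos (q ^+ 2).
Proof. by exists [:: q]; rewrite big_seq1. Qed.

Lemma sosD p q : sos p -> sos q -> sos (p + q).
Proof. by move=> [s ->] [s' ->]; exists (s ++ s'); rewrite big_cat. Qed.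

Lemma sosM p q : sos p -> sos q -> sos (p * q).
Proof.
move=> [s ->] [s' ->]; exists [seq u * v | u <- s, v <- s'].
rewrite big_distrl big_allpairs_dep /=; apply: eq_bigr => u _.
by rewrite big_distrr /=; apply: eq_bigr => v _; rewrite exprMn.
Qed.

Lemma sos_sum (I : Type) (r : seq I) (P : pred I) (F : I -> {mpoly R[N]}) :
  (forall i, P i -> sos (F i)) -> sos (\sum_(i <- r | P i) F i).
Proof. by move=> h; apply: big_ind => //; [exact: sos0 | exact: sosD]. Qed.

Lemma sosZ (c : R) p : 0 <= c -> sos p -> sos (c *: p).
Proof.
move=> c0 [s ->]; exists [seq Num.sqrt c *: q | q <- s].
by rewrite big_map scaler_sumr; apply: eq_bigr => q _; rewrite exprZn sqr_sqrtr.
Qed.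

Lemma sos_nat n : sos (n%:R : {mpoly R[N]}).
Proof.
have -> : n%:R = (n%:R : R) *: (1 : {mpoly R[N]}) ^+ 2 by rewrite expr1n scaler_nat.
by apply: sosZ (sos_sqr _); rewrite ler0n.
Qed.

(** This allows the certificate identities to be stated with denominators cleared, over any
    commutative ring. *)
Lemma sos_natI n p : (0 < n)%N -> sos (n%:R * p) -> sos p.
Proof.
move=> n0 h; have -> : p = (n%:R : R)^-1 *: (n%:R * p).
  by rewrite mulr_natl -scaler_nat scalerA mulVf ?scale1r // pnatr_eq0 -lt0n.
by apply: sosZ h; rewrite invr_ge0 ler0n.
Qed.

(** Lagrange's identity: twice this expression is the sum of all [(z i - z j) ^+ 2]. *)
Lemma sos_variance n (z : 'I_n -> {mpoly R[N]}) :
  sos (n%:R * \sum_i z i ^+ 2 - (\sum_i z i) ^+ 2).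
Proof.
apply: (@sos_natI 2) => //.
have -> : 2%:R * (n%:R * \sum_i z i ^+ 2 - (\sum_i z i) ^+ 2) =
          \sum_i \sum_j (z i - z j) ^+ 2.
  have inner i : \sum_j (z i - z j) ^+ 2 =
      n%:R * z i ^+ 2 + \sum_j z j ^+ 2 - 2%:R * (\sum_j z j) * z i.
    rewrite (eq_bigr (fun j => z i ^+ 2 + z j ^+ 2 - 2%:R * z i * z j)); last first.
      by move=> j _; ring.
    by rewrite sumrB -mulr_sumr big_split /= sumr_const card_ord -[_ *+ n]mulr_natl; ring.
  rewrite (eq_bigr _ (fun i _ => inner i)) sumrB -mulr_sumr big_split -mulr_sumr /=.
  by rewrite sumr_const card_ord -[_ *+ n]mulr_natl; ring.
by apply: sos_sum => i _; apply: sos_sum => j _; apply: sos_sqr.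
Qed.

End SumsOfSquares.

(** * The certificate of order one *)

(** The values [x] are arbitrary so that the formula serves twice: for the squared variables in the
    certificate, and after setting the isolated variables to 1 in the obstruction. *)
Lemma stab_form (R : realType) (K : comAlgType R) N m (H : graph N)
    (x : 'I_(N + m) -> K) :
  let G := dunion H (edgeless m) in
  let y i := x (lshift m i) in
  let z w := x (rshift N w) in
  \sum_i \sum_j stabmx R G i j *: (x i * x j) =
  (alpha G)%:R * (\sum_i y i * \sum_(j | closed_nbr H i j) y j + \sum_w z w ^+ 2)
    - (\sum_i y i + \sum_w z w) ^+ 2.
Proof.
move=> G y z; set A := (alpha G)%:R.
have split_sum (V : nmodType) (F : 'I_(N + m) -> V) :
    \sum_i F i = \sum_i F (lshift m i) + \sum_w F (rshift N w).
  by rewrite big_split_ord.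
have natZ n (v : K) : n%:R *: v = n%:R * v by rewrite scaler_nat mulr_natl.
have entry i j : stabmx R G i j *: (x i * x j) =
    A * (((i == j) || G i j)%:R * (x i * x j)) - x i * x j.
  rewrite !mxE scalerBl scale1r; congr (_ - _).
  rewrite -scalerA -natrD !natZ; congr (_ * (_%:R * _)).
  by have [->|_] := eqVneq i j; rewrite ?adj_irr ?addn0.
under eq_bigr do (under eq_bigr do rewrite entry; rewrite sumrB -mulr_sumr).
rewrite sumrB -mulr_sumr; congr (_ * _ - _); last first.
  by rewrite -split_sum expr2 mulr_suml; apply: eq_bigr => i _; rewrite mulr_sumr.
rewrite split_sum; congr (_ + _); apply: eq_bigr => i _.
  rewrite split_sum [X in _ + X]big1 ?addr0 => [|w _]; last first.
    by rewrite dunion_lr eq_lrshift mul0r.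
  rewrite mulr_sumr [RHS]big_mkcond; apply: eq_bigr => j _.
  rewrite dunion_ll eq_lshift /closed_nbr.
  by case: ifP => _; rewrite ?mul1r ?mul0r.
rewrite split_sum big1 ?add0r => [|w _]; last first.
  by rewrite dunion_rl eq_rlshift mul0r.
rewrite (bigD1 i) // eqxx mul1r big1 /= ?addr0 // => w wi.
by rewrite /dunion_adj !split_rshift eq_rshift eq_sym (negbTE wi) mul0r.
Qed.

Section Certificate.
Variables (K : comNzRingType) (N m k : nat) (H : graph N).
Variables (x : 'I_N -> K) (y : 'I_m -> K).

Local Notation a := (k.+1%:R : K).
Local Notation h i := (\sum_(j | closed_nbr H i j) x j).
Local Notation s := (\sum_i x i).
Local Notation t := (\sum_w y w).
Local Notation q := (\sum_w y w ^+ 2).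
Local Notation d i := (a * h i - s).

(** All dependence on [y] is absorbed by a variance and by squares completed in each [y w]; the last
    line involves [x] alone. The weighted squares vanish when [x] is the indicator of a stable set
    of size [a] and every [y w] is 1, which is a zero of the form. *)
Lemma isolated_certificate :
  4 * a ^+ 3 * ((s + t) * ((a + m%:R) * (\sum_i x i * h i + q) - (s + t) ^+ 2)) =
  4 * a ^+ 2 * (t * \sum_w (a * y w - s) ^+ 2)
  + 4 * a ^+ 3 * ((s + t) * (m%:R * q - t ^+ 2))
  + \sum_i x i * \sum_w (2 * a ^+ 2 * y w + ((a + m%:R) * d i - 2 * a * s)) ^+ 2
  + (a + m%:R) ^+ 2 * (4 * a * (s * \sum_i x i * d i) - m%:R * \sum_i x i * d i ^+ 2).
Proof.
have sumsq u v : \sum_w (u * y w + v) ^+ 2 =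
    u ^+ 2 * q + 2 * u * v * t + m%:R * v ^+ 2.
  rewrite (eq_bigr (fun w => u ^+ 2 * y w ^+ 2 + 2 * u * v * y w + v ^+ 2)).
    by rewrite !big_split /= sumr_const card_ord -!mulr_sumr -[_ *+ m]mulr_natl; ring.
  by move=> w _; ring.
set b := a + m%:R; set g := \sum_i x i * d i ^+ 2.
(* Weighted by [x i], any quadratic in [d i] sums to an expression in [s], the sum of the
   [x i * h i], and [g]. Both sides of the identity thus become polynomials in finitely many
   quantities. *)
have quad u v w : \sum_i x i * (u + v * d i + w * d i ^+ 2) =
    u * s + v * (a * (\sum_i x i * h i) - s ^+ 2) + w * g.
  have <- : \sum_i x i * d i = a * (\sum_i x i * h i) - s ^+ 2.
    under eq_bigr do rewrite mulrBr mulrCA.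
    by rewrite sumrB -mulr_sumr -mulr_suml expr2.
  rewrite [u * _]mulr_sumr [v * _]mulr_sumr [w * _]mulr_sumr -!big_split /=.
  by apply: eq_bigr => i _; ring.
have -> : \sum_w (a * y w - s) ^+ 2 = a ^+ 2 * q - 2 * a * s * t + m%:R * s ^+ 2.
  by rewrite sumsq; ring.
rewrite [X in _ = _ + X + _](eq_bigr (fun i => x i *
  ((4 * a ^+ 4 * q - 8 * a ^+ 3 * s * t + 4 * m%:R * a ^+ 2 * s ^+ 2)
   + (4 * a ^+ 2 * b * t - 4 * m%:R * a * b * s) * d i
   + m%:R * b ^+ 2 * d i ^+ 2))); last by move=> i _; rewrite sumsq; ring.
have f_def := quad 0 1 0; rewrite mul0r add0r mul1r mul0r addr0 in f_def.
have -> : \sum_i x i * d i = a * (\sum_i x i * h i) - s ^+ 2.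
  by rewrite -f_def; apply: eq_bigr => i _; ring.
by rewrite quad /b; ring.
Qed.

(** The identity holds for each [i] separately: with [r i = s - h i] one has [d i = k h i - r i],
    and this factors out of both sides, leaving [k (h i + r i) = k s]. *)
Lemma alpha_critical_certificate :
  k%:R * (s * \sum_i x i * d i) =
  a * \sum_i x i * ((s - h i) * (k%:R * h i - (s - h i))) + \sum_i x i * d i ^+ 2.
Proof.
by rewrite !mulr_sumr -!big_split /=; apply: eq_bigr => i _; ring.
Qed.

(** [B i C] is the total weight of one clique of the cover at [i], so the first sum on the right
    consists of variances. The index set [e] collects what remains of the neighbourhood of [j]
    outside its clique, and contributes monomials with positive coefficients only. *)
Lemma nonneighbour_certificate (c : 'I_N -> 'I_N -> 'I_k) :
  nonneighbours_clique_cover H c ->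
  let B i C := \sum_(j | ~~ closed_nbr H i j && (c i j == C)) x j in
  let e i j l := ~~ closed_nbr H i j && closed_nbr H j l &&
                 ~~ (~~ closed_nbr H i l && (c i j == c i l)) in
  \sum_i x i * ((s - h i) * (k%:R * h i - (s - h i))) =
  \sum_i x i * (k%:R * \sum_C B i C ^+ 2 - (\sum_C B i C) ^+ 2)
  + k%:R * \sum_i \sum_j \sum_(l | e i j l) x i * x j * x l.
Proof.
move=> cov B e.
pose r i := \sum_(j | ~~ closed_nbr H i j) x j.
have rE i : s - h i = r i.
  by rewrite [s](bigID (closed_nbr H i)) /= addrAC subrr add0r.
have sumB i : \sum_C B i C = r i.
  by rewrite /r (partition_big (c i) predT).
have sumB2 i : \sum_C B i C ^+ 2 = \sum_(j | ~~ closed_nbr H i j)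
    x j * \sum_(l | ~~ closed_nbr H i l && (c i j == c i l)) x l.
  rewrite [RHS](partition_big (c i) predT) //=; apply: eq_bigr => C _.
  rewrite expr2 /B mulr_suml; apply: eq_bigr => j /andP[_ /eqP cij].
  by congr (_ * _); apply: eq_bigl => l; rewrite cij eq_sym.
(* Non-adjacency is symmetric, so exchanging the two summation indices replaces [h i] by [h j]. *)
have swap : \sum_i x i * (r i * h i) =
    \sum_i x i * \sum_(j | ~~ closed_nbr H i j) x j * h j.
  transitivity (\sum_i \sum_(j | ~~ closed_nbr H i j) x i * x j * h i).
    apply: eq_bigr => i _; rewrite /r mulr_suml mulr_sumr; apply: eq_bigr => j _.
    by rewrite mulrA.
  rewrite (exchange_big_dep predT) //=; apply: eq_bigr => j _.
  rewrite mulr_sumr; apply: eq_big => [i|i _]; first by rewrite closed_nbrC.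
  by rewrite mulrA [x i * _]mulrC.
(* The clique property enters here: the class of [j] lies inside its closed neighbourhood. *)
have nbr_split i j : ~~ closed_nbr H i j -> h j =
    \sum_(l | ~~ closed_nbr H i l && (c i j == c i l)) x l
    + \sum_(l | e i j l) x l.
  move=> ij; rewrite (bigID (fun l => ~~ closed_nbr H i l && (c i j == c i l))) /=.
  congr (_ + _); apply: eq_bigl => l; last by rewrite /e ij.
  by apply: andb_idl => /andP[il /eqP ejl]; apply: cov ij il ejl.
have -> : \sum_i x i * ((s - h i) * (k%:R * h i - (s - h i))) =
    k%:R * (\sum_i x i * (r i * h i)) - \sum_i x i * r i ^+ 2.
  by rewrite mulr_sumr -sumrB; apply: eq_bigr => i _; rewrite rE; ring.
have -> : \sum_i x i * (k%:R * \sum_C B i C ^+ 2 - (\sum_C B i C) ^+ 2) =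
    k%:R * (\sum_i x i * \sum_C B i C ^+ 2) - \sum_i x i * r i ^+ 2.
  by rewrite mulr_sumr -sumrB; apply: eq_bigr => i _; rewrite sumB; ring.
rewrite addrAC -mulrDr; congr (_ * _ - _).
rewrite swap -big_split /=; apply: eq_bigr => i _.
rewrite sumB2 [X in _ = _ + X](bigID (closed_nbr H i)) /=.
rewrite [X in _ = _ + (X + _)]big1 => [|j ij]; last first.
  by rewrite big_pred0 // => l; rewrite /e ij.
rewrite add0r !mulr_sumr -big_split; apply: eq_bigr => j ij /=.
by rewrite (nbr_split i) // !mulrDr -[in RHS]mulr_sumr [x i * (_ * \sum_(l | e _ _ _) _)]mulrA.
Qed.

End Certificate.

Lemma stabmx_sym (R : realType) N (G : graph N) : (stabmx R G)^T = stabmx R G.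
Proof.
by apply/matrixP => i j; rewrite !mxE adj_sym [(j == i)]eq_sym.
Qed.

Lemma sos_stab_form (R : realType) n N m k (H : graph N)
    (c : 'I_N -> 'I_N -> 'I_k) (x : 'I_N -> {mpoly R[n]})
    (y : 'I_m -> {mpoly R[n]}) :
  nonneighbours_clique_cover H c -> (0 < k)%N -> (m * k <= 4 * k.+1)%N ->
  (forall i, sos (x i)) -> (forall w, sos (y w)) ->
  sos ((\sum_i x i + \sum_w y w) *
    ((k.+1%:R + m%:R) *
       (\sum_i x i * \sum_(j | closed_nbr H i j) x j + \sum_w y w ^+ 2)
     - (\sum_i x i + \sum_w y w) ^+ 2)).
Proof.
move=> cov k0 mk sosx sosy.
have sums : sos (\sum_i x i) by apply: sos_sum.
have sumt : sos (\sum_w y w) by apply: sos_sum.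
have sos_nat_pow a e : sos (a%:R ^+ e : {mpoly R[n]}) by rewrite -natrX; apply: sos_nat.
(* This factor is the one on the left of [isolated_certificate]. *)
apply: (@sos_natI _ _ (4 * k.+1 ^ 3)) => //.
rewrite natrM natrX isolated_certificate.
apply: sosD; first apply: sosD; first apply: sosD.
- rewrite -natrX -natrM; apply: sosM; first exact: sos_nat.
  by apply: sosM => //; apply: sos_sum => w _; apply: sos_sqr.
- rewrite -natrX -natrM; apply: sosM; first exact: sos_nat.
  by apply: sosM; [apply: sosD | apply: sos_variance].
- apply: sos_sum => i _; apply: sosM => //.
  by apply: sos_sum => w _; apply: sos_sqr.
rewrite -natrD; apply: sosM; first exact: sos_nat_pow.
(* The remaining part in [x] is multiplied by [k] to match [alpha_critical_certificate]. *)
apply: (@sos_natI _ _ k) => //.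
set g := \sum_i x i * _ ^+ 2.
have sosg : sos g by apply: sos_sum => i _; apply: sosM => //; apply: sos_sqr.
rewrite mulrBr mulrCA alpha_critical_certificate -/g.
rewrite (nonneighbour_certificate x cov) /=.
set Z := \sum_i _ + _.
have sosZ : sos Z.
  apply: sosD.
    by apply: sos_sum => i _; apply: sosM => //; apply: sos_variance.
  apply: sosM; first exact: sos_nat.
  do 3![apply: sos_sum => ? _].
  by apply: sosM => //; apply: sosM.
(* The hypothesis on [m] is exactly that the coefficient left in front of [g] is nonnegative. *)
have -> : 4 * k.+1%:R * (k.+1%:R * Z + g) - k%:R * (m%:R * g) =
    4%:R * (k.+1%:R ^+ 2 * Z) + (4 * k.+1 - m * k)%:R * g.
  by rewrite natrB // !natrM; ring.
by apply: sosD; [apply: sosM; [|apply: sosM => //] | apply: sosM => //]; try exact: sos_nat.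
Qed.

Lemma in_K1_dunion_edgeless (R : realType) N m k (H : graph N)
    (c : 'I_N -> 'I_N -> 'I_k) :
  nonneighbours_clique_cover H c -> alpha H = k.+1 -> (0 < k)%N ->
  (m * k <= 4 * k.+1)%N -> in_K 1 (stabmx R (dunion H (edgeless m))).
Proof.
move=> cov alphaH k0 mk; split; first exact: stabmx_sym.
rewrite expr1 (stab_form H (fun i => 'X_i ^+ 2 : {mpoly R[N + m]})).
rewrite alpha_dunion_edgeless alphaH natrD big_split_ord /=.
by apply: (sos_stab_form cov) => // i; apply: sos_sqr.
Qed.

(** * Vanishing and coefficients of low-degree summands *)

Section LowDegree.
Variables (R : realType) (N : nat).
Implicit Types p q : {mpoly R[N]}.

Lemma msizeM_deg p q a b :
  (msize p <= a.+1 -> msize q <= b.+1 -> msize (p * q) <= (a + b).+1)%N.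
Proof.
have [->|p0] := eqVneq p 0; first by rewrite mul0r msize0.
have [->|q0] := eqVneq q 0; first by rewrite mulr0 msize0.
by rewrite msizeM //; move: (msize p) (msize q) => u v; lia.
Qed.

Lemma msizeD_deg p q a :
  (msize p <= a -> msize q <= a -> msize (p + q) <= a)%N.
Proof.
by move=> hp hq; apply: leq_trans (mmeasureD_le _ _ _) _; rewrite geq_max hp.
Qed.

Lemma msize_sum_deg (I : Type) (r : seq I) (P : pred I) (F : I -> {mpoly R[N]}) a :
  (forall i, P i -> (msize (F i) <= a)%N) ->
  (msize (\sum_(i <- r | P i) F i) <= a)%N.
Proof.
move=> h; elim/big_ind: _ => //; first by rewrite msize0.
by move=> p q; apply: msizeD_deg.
Qed.

(* The squares of the largest leading monomials cannot cancel. *)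
Lemma msize_sos_summand (s : seq {mpoly R[N]}) d q :
  (msize (\sum_(p <- s) p ^+ 2)%R <= (2 * d).+1)%N -> q \in s ->
  (msize q <= d.+1)%N.
Proof.
move=> hs qs; have [->|q0] := eqVneq q 0; first by rewrite msize0.
have [p [ps pmax]] : exists p, p \in s /\ forall p', p' \in s -> (mlead p' <= mlead p)%O.
  elim: s {hs} q qs {q0} => // p s IH q _.
  case: s IH => [|p1 s] IH.
    by exists p; split=> [|p']; rewrite !inE // => /eqP->.
  have [p2 [p2s p2max]] := IH p1 (mem_head _ _).
  case: (leP (mlead p) (mlead p2)) => le_p.
    exists p2; split; first by rewrite inE p2s orbT.
    by move=> p'; rewrite inE => /orP[/eqP->//|]; apply: p2max.
  exists p; split; first by rewrite inE eqxx.
  move=> p'; rewrite inE => /orP[/eqP->//|/p2max le2].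
  by rewrite (le_trans le2) // ltW.
(* Since [mlead 0] is the monomial 1, the chosen [p] may be zero; then [q] is constant. *)
have [p0|p0] := eqVneq p 0.
  have := pmax _ qs; rewrite p0 mlead0 => /lemc_mdeg; rewrite mdeg0 leqn0.
  by move=> /eqP dq; rewrite -mlead_deg // dq.
have pos : 0 < (\sum_(p <- s) p ^+ 2)@_(mlead p + mlead p).
  have sq r : r \in s -> (r ^+ 2)@_(mlead p + mlead p) = r@_(mlead p) ^+ 2.
    by move=> rs; rewrite !expr2 mleadcMW ?pmax.
  rewrite raddf_sum /= (big_rem _ ps) /= sq // ltr_pwDl //.
    by rewrite exprn_even_gt0 //= mleadc_eq0.
  rewrite big_seq sumr_ge0 // => r /mem_rem rs.
  by rewrite sq // sqr_ge0.
have /msize_mdeg_lt : (mlead p + mlead p)%MM \in msupp (\sum_(p <- s) p ^+ 2).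
  by rewrite -[_ \in _]negbK -mcoeff_eq0 gt_eqF.
move/leq_trans => /(_ _ hs); rewrite mdegD => lt_deg.
have := lemc_mdeg (pmax _ qs); rewrite -(mlead_deg q0) => le_deg.
by lia.
Qed.

End LowDegree.

(** * Sign averages and restriction to a coordinate axis *)

Section Restrictions.
Variables (R : realType) (N : nat).
Implicit Types (q : {mpoly R[N]}) (m : 'X_{1..N}).

Lemma mcoeff_select q m0 : \sum_(m <- msupp q) q@_m * (m == m0)%:R = q@_m0.
Proof.
by rewrite [in RHS](mpolyE q) raddf_sum; apply: eq_bigr => m _; rewrite /= mcoeffZ mcoeffX.
Qed.

Lemma even_monomial m : (mdeg m <= 3)%N -> (forall j, ~~ odd (m j)) ->
  m != 0%MM -> exists j, m = (U_(j) *+ 2)%MM.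
Proof.
move=> deg ev m0.
have [j mj] : exists j, m j != 0%N.
  apply/existsP; apply: contraR m0; rewrite negb_exists => /forallP h.
  by apply/eqP/mnmP => i; rewrite mnm0E; apply/eqP; move: (h i); rewrite negbK.
exists j; apply/mnmP => i; rewrite mulmnE mnm1E.
move: deg; rewrite mdegE (bigD1 j) //=; move: (ev j) mj.
have [<- evj mj deg|ji evj mj] := eqVneq j i.
  by move: (m j) evj mj deg => [|[|[|[|e]]]] //=; lia.
rewrite (bigD1 i) ?[i == j]eq_sym //= => deg.
by move: (ev i) evj mj deg; move: (m i) (m j) => e f; lia.
Qed.

(** Signs are indexed by all coordinates, including those outside [S] where they have no effect;
    this lets sums over [e] factor coordinate by coordinate. *)
Definition sign_point (S : {set 'I_N}) (e : {ffun 'I_N -> bool}) : 'I_N -> R :=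
  fun j => if j \in S then (-1) ^+ e j else 0.

(** The sum factors over coordinates. An odd exponent gives the factor 0, exponent 0 gives 2, and
    exponent 2 gives 2 on [S] and 0 elsewhere; degree at most 3 leaves no other even monomials. *)
Lemma sign_moment (S : {set 'I_N}) m : (mdeg m <= 3)%N ->
  \sum_e \prod_j sign_point S e j ^+ m j =
  (2 ^+ N) * ((m == 0%MM)%:R + \sum_(j in S) (m == U_(j) *+ 2)%MM%:R).
Proof.
move=> deg.
pose w j d := \sum_(b : bool) (if j \in S then (-1) ^+ b else 0 : R) ^+ d.
have -> : \sum_e \prod_j sign_point S e j ^+ m j = \prod_j w j (m j).
  by rewrite bigA_distr_bigA.
have w0 j : w j 0%N = 2 by rewrite /w big_bool /= !expr0.
have w_odd j d : odd d -> w j d = 0.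
  move=> od; rewrite /w big_bool /= expr0 expr1; case: ifP => _.
    by rewrite expr1n -signr_odd od expr1 addNr.
  by rewrite expr0n; case: d od => // d _; rewrite addr0.
have w2 j : w j 2%N = 2 * (j \in S)%:R.
  rewrite /w big_bool /= expr0 expr1; case: ifP => _.
    by rewrite sqrrN expr1n mulr1.
  by rewrite expr0n addr0 mulr0.
have U2_inj i j : (U_(i) *+ 2 == U_(j) *+ 2)%MM = (i == j).
  apply/eqP/eqP => [/mnmP/(_ j)|->//]; rewrite !mulmnE !mnm1E eqxx.
  by case: eqP.
have U2_neq0 i : (U_(i) *+ 2 == 0)%MM = false.
  by rewrite -mdeg_eq0 mdegMn mdeg1.
case: (boolP [forall j, ~~ odd (m j)]) => [/forallP ev|]; last first.
  rewrite negb_forall => /existsP[j]; rewrite negbK => oj.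
  rewrite (bigD1 j) //= w_odd // mul0r big1 => [|i _]; last first.
    by case: eqP oj => // ->; rewrite mulmnE oddM andbF.
  by case: eqP oj => [->|_]; rewrite ?mnm0E // addr0 mulr0.
have [->|m0] := eqVneq m 0%MM.
  rewrite [X in _ = _ * (_ + X)]big1 => [|i _]; last by rewrite eq_sym U2_neq0.
  rewrite (eq_bigr (fun=> 2)) => [|i _]; last by rewrite mnm0E w0.
  by rewrite prodr_const card_ord addr0 mulr1.
have [j mE] := even_monomial deg ev m0; rewrite {m deg ev m0}mE.
rewrite mulr0n add0r [X in _ = _ * X](eq_bigr (fun i => (j == i)%:R)) => [|i _]; last first.
  by rewrite U2_inj.
rewrite (bigD1 j) //= mulmnE mnm1E eqxx w2.
rewrite (eq_bigr (fun=> 2)) => [|i ij]; last first.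
  by rewrite mulmnE mnm1E eq_sym (negbTE ij) w0.
rewrite mulrAC -[X in X * _ * _](expr1 2) prodr_const cardC1 card_ord.
have N0 : (0 < N)%N by apply: leq_trans (ltn_ord j).
rewrite -exprD add1n prednK //; congr (_ * _).
rewrite big_mkcond (bigD1 j) //= eqxx big1 ?addr0 => [|i ij]; last first.
  by rewrite eq_sym (negbTE ij) if_same.
by case: ifP.
Qed.

(* Averaging over all signs keeps only the monomials with even exponents. *)
Lemma sign_average q (S : {set 'I_N}) : (msize q <= 4)%N ->
  (forall e, q.@[sign_point S e] = 0) ->
  q@_0 + \sum_(j in S) q@_(U_(j) *+ 2) = 0.
Proof.
move=> deg van; apply: (@mulfI _ (2 ^+ N)); first by rewrite expf_neq0 ?pnatr_eq0.
rewrite mulr0.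
have avg : \sum_e q.@[sign_point S e] = 0 by apply: big1.
rewrite -[RHS]avg {avg}.
under [RHS]eq_bigr do rewrite mevalE.
rewrite [RHS]exchange_big /= -mcoeff_select.
under [X in _ + X]eq_bigr do rewrite -mcoeff_select.
rewrite [X in _ + X]exchange_big -big_split mulr_sumr /= big_seq [RHS]big_seq.
apply: eq_bigr => m /msize_mdeg_lt mlt.
rewrite -!mulr_sumr sign_moment; last by move: mlt; move: (msize q) deg => u; lia.
by rewrite -mulrDr mulrCA.
Qed.

Definition axis_restriction (i : 'I_N) : {mpoly R[N]} -> {poly R} :=
  mmap (@polyC R) (fun j => if j == i then 'X else 0).

HB.instance Definition _ i := GRing.RMorphism.copy (axis_restriction i)
  (mmap (@polyC R) (fun j => if j == i then 'X else 0)).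

Lemma axis_restrictionX i j : axis_restriction i 'X_j = if j == i then 'X else 0.
Proof. by rewrite /axis_restriction mmapX mmap1U. Qed.

Lemma coef_axis_restriction i q d :
  (axis_restriction i q)`_d = q@_(U_(i) *+ d).
Proof.
rewrite /axis_restriction /mmap coef_sum -mcoeff_select.
apply: eq_bigr => m _; rewrite coefCM; congr (_ * _).
rewrite /mmap1; have [->|neq] := eqVneq m (U_(i) *+ d)%MM.
  rewrite (bigD1 i) //= eqxx mulmnE mnm1E eqxx mul1n big1 ?mulr1 ?coefXn ?eqxx //.
  by move=> j ji; rewrite mulmnE mnm1E [i == j]eq_sym (negbTE ji) mul0n expr0.
case: (boolP [forall j, (j != i) ==> (m j == 0%N)]) => [/forallP h|].
  rewrite (bigD1 i) //= eqxx big1 ?mulr1 ?coefXn => [|j ji]; last first.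
    by have /implyP/(_ ji)/eqP-> := h j.
  case: eqP => // dm; case/eqP: neq; apply/mnmP => j.
  rewrite mulmnE mnm1E; have [<-|ij] := eqVneq i j; first by rewrite mul1n dm.
  by have := h j; rewrite eq_sym ij => /eqP.
rewrite negb_forall => /existsP[j]; rewrite negb_imply => /andP[ji mj].
by rewrite (bigD1 j) //= (negbTE ji) expr0n (negbTE mj) mul0r coef0.
Qed.

End Restrictions.

(** * The obstruction *)

Lemma cauchy_schwarz_seq (R : realType) (I : Type) (s : seq I) (f g : I -> R) :
  (\sum_(i <- s) f i * g i) ^+ 2 <=
  (\sum_(i <- s) f i ^+ 2) * (\sum_(i <- s) g i ^+ 2).
Proof.
have h : 0 <= \sum_(i <- s) \sum_(j <- s) (f i * g j - f j * g i) ^+ 2.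
  by apply: sumr_ge0 => i _; apply: sumr_ge0 => j _; apply: sqr_ge0.
set F := \sum_(i <- s) f i ^+ 2; set G := \sum_(i <- s) g i ^+ 2.
set D := \sum_(i <- s) f i * g i.
have inner i : \sum_(j <- s) (f i * g j - f j * g i) ^+ 2 =
    f i ^+ 2 * G - 2 * D * (f i * g i) + F * g i ^+ 2.
  rewrite -mulrA mulr_sumr [D * _]mulr_suml mulr_suml mulr_sumr -sumrB -big_split /=.
  by apply: eq_bigr => j _; ring.
move: h; rewrite (eq_bigr _ (fun i _ => inner i)) big_split sumrB /=.
by rewrite -mulr_suml -mulr_sumr -mulr_sumr -/F -/G -/D; lra.
Qed.

Section Refutation.
Variables (R : realType) (N m a r : nat) (H : graph N).
Hypotheses (alphaH : alpha H = a) (detH : stable_sets_determine R H a).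

(** This is the expression of [stab_form] with every isolated variable equal to 1; it has degree
    four once each [x i] is a squared variable. *)
Definition stab_quartic (K : comNzRingType) (x : 'I_N -> K) : K :=
  (a + m)%:R * (\sum_i x i * (\sum_(j | closed_nbr H i j) x j) + m%:R)
  - (\sum_i x i + m%:R) ^+ 2.

Lemma dehomogenize : in_K r (stabmx R (dunion H (edgeless m))) ->
  exists s : seq {mpoly R[N]}, \sum_(q <- s) q ^+ 2 =
    (\sum_i 'X_i ^+ 2 + m%:R) ^+ r * stab_quartic (fun i => 'X_i ^+ 2).
Proof.
move=> [_ [s sE]].
pose lq := [tuple match split i with inl j => 'X_j | inr _ => 1 end
            | i < N + m] : (N + m).-tuple {mpoly R[N]}.
pose x (i : 'I_(N + m)) : {mpoly R[N]} :=
  match split i with inl j => 'X_j ^+ 2 | inr _ => 1 end.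
have xl i : x (lshift m i) = 'X_i ^+ 2 by rewrite /x split_lshift.
have xr w : x (rshift N w) = 1 by rewrite /x split_rshift.
have XE i : comp_mpoly lq 'X_i ^+ 2 = x i.
  by rewrite comp_mpolyXU -tnth_nth tnth_mktuple /x; case: split; rewrite ?expr1n.
exists [seq comp_mpoly lq q | q <- s].
have := congr1 (comp_mpoly lq) sE; rewrite [RHS]raddf_sum /= big_map.
under [in RHS]eq_bigr do rewrite rmorphXn.
move=> <-; rewrite rmorphM rmorphXn !raddf_sum /=.
have -> : \sum_i comp_mpoly lq ('X_i ^+ 2) = \sum_i 'X_i ^+ 2 + m%:R.
  under eq_bigr do rewrite rmorphXn /= XE.
  rewrite big_split_ord /= (eq_bigr _ (fun i _ => xl i)).
  by rewrite (eq_bigr _ (fun w _ => xr w)) sumr_const card_ord.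
congr (_ * _).
rewrite (eq_bigr (fun i => \sum_j stabmx R (dunion H (edgeless m)) i j *: (x i * x j))).
  rewrite stab_form alpha_dunion_edgeless alphaH /stab_quartic.
  rewrite (eq_bigr _ (fun i _ => xl i)) (eq_bigr _ (fun w _ => xr w)).
  rewrite sumr_const card_ord.
  rewrite [\sum_w x (rshift N w) ^+ 2](eq_bigr (fun=> 1)) => [|w _]; last by rewrite xr expr1n.
  rewrite sumr_const card_ord; congr (_ * (_ + _) - _).
  by apply: eq_bigr => i _; rewrite xl; congr (_ * _); apply: eq_bigr => j _.
move=> i _; rewrite raddf_sum /=; apply: eq_bigr => j _.
by rewrite comp_mpolyZ rmorphM !rmorphXn /= !XE.
Qed.

(** The closed neighbourhood of a vertex of [S] meets [S] in that vertex only, so both terms equal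
    the square of [a + m]. *)
Lemma stab_quartic_sign_point (S : {set 'I_N}) e : stable H S -> #|S| = a ->
  stab_quartic (fun i => sign_point R S e i ^+ 2) = 0.
Proof.
move=> /stableP st cS.
have sq i : sign_point R S e i ^+ 2 = (i \in S)%:R.
  rewrite /sign_point; case: ifP => _; last by rewrite expr0n.
  by rewrite sqrr_sign.
have total : \sum_i sign_point R S e i ^+ 2 = a%:R.
  rewrite (eq_bigr _ (fun i _ => sq i)) -cS -sum1_card natr_sum.
  by rewrite [RHS]big_mkcond; apply: eq_bigr => i _; case: (i \in S).
rewrite /stab_quartic total (eq_bigr (fun i => sign_point R S e i ^+ 2)).
  by rewrite total -natrD; ring.
move=> i _; rewrite sq; case: (boolP (i \in S)) => iS; last by rewrite mul0r.
rewrite (bigD1 i) /=; last by rewrite /closed_nbr eqxx.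
rewrite sq iS big1 ?addr0 ?mulr1 // => j /andP[ij ji].
rewrite sq; case: (boolP (j \in S)) => // jS.
by move: ij; rewrite /closed_nbr eq_sym (negbTE ji) (negbTE (st _ _ iS jS)).
Qed.

(** The certificate has degree at most 6, so its summands have degree at most 3 and [sign_average]
    applies. The relation it yields concerns the coefficients of 1 and of the squared variables,
    which the restriction to an axis preserves. *)
Lemma univariate_sos (i : 'I_N) : (r <= 1)%N ->
  in_K r (stabmx R (dunion H (edgeless m))) ->
  exists s : seq {poly R},
    (forall p, p \in s -> (size p <= 4)%N /\ a%:R * p`_2 = - p`_0) /\
    \sum_(p <- s) p ^+ 2 = ('X ^+ 2 + m%:R) ^+ r *
      ((a + m)%:R * ('X ^+ 2 * 'X ^+ 2 + m%:R) - ('X ^+ 2 + m%:R) ^+ 2).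
Proof.
move=> r1 /dehomogenize[s sE].
exists [seq axis_restriction i q | q <- s]; split.
  have degX j : (msize ('X_j ^+ 2 : {mpoly R[N]}) <= 3)%N.
    by rewrite mpolyXn msizeX mdegMn mdeg1.
  have deg_nat e b : (msize (e%:R : {mpoly R[N]}) <= b.+1)%N.
    by rewrite -mpolyC_nat msizeC; case: (_ != _).
  have deg_s e : (msize (\sum_j 'X_j ^+ 2 + e%:R : {mpoly R[N]}) <= 3)%N.
    by apply: msizeD_deg => //; apply: msize_sum_deg.
  have deg : (msize (\sum_(q <- s) q ^+ 2)%R <= (2 * 3).+1)%N.
    rewrite sE; apply: (@msizeM_deg _ _ _ _ 2 4).
      by case: r r1 => [|[]] // _; rewrite ?expr0 ?expr1 // (deg_nat 1%N).
    apply: msizeD_deg; last first.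
      by rewrite mmeasureN expr2; apply: (@msizeM_deg _ _ _ _ 2 2).
    apply: (@msizeM_deg _ _ _ _ 0 4) => //; apply: msizeD_deg => //.
    apply: msize_sum_deg => j _; apply: (@msizeM_deg _ _ _ _ 2 2) => //.
    exact: msize_sum_deg.
  move=> _ /mapP[q qs ->]; have degq := msize_sos_summand deg qs.
  split.
    apply/leq_sizeP => d d4; rewrite coef_axis_restriction.
    by apply/memN_msupp_eq0/msize_mdeg_ge; rewrite mdegMn mdeg1 mul1n (leq_trans degq).
  rewrite !coef_axis_restriction mulm0n.
  (* The relations over all maximum stable sets are solved for the coefficients of the squared
     variables, with [u0] minus the constant coefficient. *)
  apply: (detH (u := fun j => q@_(U_(j) *+ 2))) => S stS cS.
  apply/eqP; rewrite -addr_eq0 addrC; apply/eqP/sign_average => // e.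
  have : \sum_(p <- s) p.@[sign_point R S e] ^+ 2 = 0.
    under eq_bigr do rewrite -rmorphXn.
    rewrite -raddf_sum /= sE rmorphM /=.
    suff -> : (stab_quartic (fun j => 'X_j ^+ 2)).@[sign_point R S e] = 0 by rewrite mulr0.
    rewrite -(stab_quartic_sign_point e stS cS) /stab_quartic.
    rewrite rmorphB rmorphXn rmorphM !rmorphD !rmorph_nat !rmorph_sum /=.
    congr (_ * (_ + _) - (_ + _) ^+ 2); apply: eq_bigr => j _.
      rewrite rmorphM rmorph_sum rmorphXn /= mevalXU; congr (_ * _).
      by apply: eq_bigr => l _; rewrite rmorphXn /= mevalXU.
    by rewrite rmorphXn /= mevalXU.
  (* A vanishing sum of real squares forces each summand, in particular [q], to vanish at the
     point. *)
  rewrite (big_rem _ qs) /= => /eqP; rewrite paddr_eq0 ?sqr_ge0 //; last first.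
    by apply: sumr_ge0 => p _; apply: sqr_ge0.
  by rewrite sqrf_eq0 => /andP[/eqP].
rewrite big_map; under eq_bigr do rewrite -rmorphXn.
rewrite -raddf_sum /= sE rmorphM rmorphXn /stab_quartic.
rewrite rmorphB rmorphXn rmorphM !rmorphD !rmorph_nat !rmorph_sum /=.
have sq j : axis_restriction i ('X_j ^+ 2) = if j == i then 'X ^+ 2 else 0 :> {poly R}.
  by rewrite rmorphXn /= axis_restrictionX; case: eqP; rewrite ?expr0n.
have -> : \sum_j axis_restriction i ('X_j ^+ 2) = 'X ^+ 2 :> {poly R}.
  by rewrite (bigD1 i) //= sq eqxx big1 ?addr0 // => j /negbTE ji; rewrite sq ji.
congr (_ * (_ * (_ + _) - _)).
rewrite (bigD1 i) //= rmorphM rmorph_sum /= sq eqxx.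
rewrite (bigD1 i) /=; last by rewrite /closed_nbr eqxx.
rewrite sq eqxx big1 ?addr0 => [|j /andP[_ /negbTE ji]]; last by rewrite sq ji.
by rewrite big1 ?addr0 // => j /negbTE ji; rewrite rmorphM /= sq ji mul0r.
Qed.

End Refutation.

(** * Comparison of coefficients in orders zero and one *)

Section Endgame.
Variables (R : realType) (N m a : nat) (H : graph N).
Hypotheses (alphaH : alpha H = a) (detH : stable_sets_determine R H a).
Hypotheses (a2 : (1 < a)%N) (i0 : 'I_N).

Lemma coef_sqr_cubic (p : {poly R}) : (size p <= 4)%N ->
  [/\ (p ^+ 2)`_0 = p`_0 ^+ 2, (p ^+ 2)`_2 = 2 * (p`_0 * p`_2) + p`_1 ^+ 2,
      (p ^+ 2)`_4 = 2 * (p`_3 * p`_1) + p`_2 ^+ 2 & (p ^+ 2)`_6 = p`_3 ^+ 2].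
Proof.
move=> sp; have p0 d : (3 < d)%N -> p`_d = 0.
  by move=> d3; rewrite nth_default // (leq_trans sp).
split; rewrite expr2 coefM !big_ord_recl big_ord0 /= ?(p0 4%N) ?(p0 5%N) ?(p0 6%N) //;
  rewrite /bump /=; ring.
Qed.

(** Substituting [p_2 = - p_0 / a] expresses the even coefficients of [P] through the sums of
    [p_0 ^+ 2], [p_1 ^+ 2], [p_3 ^+ 2] and [p_3 * p_1]. The witness is the last of these, bounded by
    Cauchy-Schwarz. *)
Lemma sum_coef_sqr_cubic (s : seq {poly R}) :
  (forall p, p \in s -> (size p <= 4)%N /\ a%:R * p`_2 = - p`_0) ->
  let P := \sum_(p <- s) p ^+ 2 in
  exists S13,
    [/\ S13 ^+ 2 <= P`_6 * (P`_2 + 2 * P`_0 / a%:R) &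
        P`_4 = 2 * S13 + P`_0 / a%:R ^+ 2].
Proof.
move=> hs P.
have a0 : a%:R != 0 :> R by rewrite pnatr_eq0; lia.
have p2 p : p \in s -> p`_2 = - p`_0 / a%:R.
  by case/hs => _ e; apply: (mulfI a0); rewrite e mulrCA mulfV // mulr1.
pose S00 := \sum_(p <- s) p`_0 ^+ 2.
exists (\sum_(p <- s) p`_3 * p`_1).
have e0 : P`_0 = S00.
  rewrite coef_sum big_seq [RHS]big_seq; apply: eq_bigr => p ps.
  by have [/coef_sqr_cubic[]] := hs p ps.
have e2 : P`_2 = \sum_(p <- s) p`_1 ^+ 2 - 2 * S00 / a%:R.
  rewrite coef_sum /S00 [2 * _]mulr_sumr mulr_suml -sumrB big_seq [RHS]big_seq.
  apply: eq_bigr => p ps; have [/coef_sqr_cubic[_ -> _ _] _] := hs p ps.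
  by rewrite p2 //; field.
have e4 : P`_4 = 2 * (\sum_(p <- s) p`_3 * p`_1) + S00 / a%:R ^+ 2.
  rewrite coef_sum /S00 mulr_sumr mulr_suml -big_split /= big_seq [RHS]big_seq.
  apply: eq_bigr => p ps; have [/coef_sqr_cubic[_ _ -> _] _] := hs p ps.
  by rewrite p2 //; field.
have e6 : P`_6 = \sum_(p <- s) p`_3 ^+ 2.
  rewrite coef_sum big_seq [RHS]big_seq; apply: eq_bigr => p ps.
  by have [/coef_sqr_cubic[]] := hs p ps.
rewrite e0 {1}e2 e4 e6 subrK; split=> //.
exact: cauchy_schwarz_seq.
Qed.

Lemma not_in_K0_dunion_edgeless : ~ in_K 0 (stabmx R (dunion H (edgeless m))).
Proof.
move=> /(univariate_sos alphaH detH i0 (leq0n _)) [s [/sum_coef_sqr_cubic[S13]]].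
rewrite /= => + sE; rewrite sE expr0 mul1r.
have -> : (a + m)%:R * ('X ^+ 2 * 'X ^+ 2 + m%:R) - ('X ^+ 2 + m%:R) ^+ 2 =
    ((a + m)%:R - 1 : R)%:P * 'X ^+ 4 + (- (2 * m%:R))%:P * 'X ^+ 2 + (m%:R * a%:R)%:P.
  by rewrite !(polyCD, polyCN, polyCM, polyC_natr, polyC1) ; ring.
rewrite !(coefD, coefCM, coefXn, coefC) /= !(mulr0, mulr1, add0r, addr0, mul0r).
move=> [cs e4].
(* In order 0 the coefficient of degree 6 is zero. The relation in degree 4 then amounts to
   [(a - 1) (a + m) = 0], impossible for [a >= 2]. *)
have S0 : S13 = 0 by apply/eqP; rewrite -sqrf_eq0 eq_le cs sqr_ge0.
have a1 : 2 <= a%:R :> R by rewrite ler_nat.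
have m0 : 0 <= m%:R :> R by apply: ler0n.
have a0 : a%:R != 0 :> R by rewrite pnatr_eq0; lia.
move: e4; rewrite S0 natrD => /(congr1 (fun z => z * a%:R)).
have -> : (2 * 0 + m%:R * a%:R / a%:R ^+ 2) * a%:R = m%:R :> R by field.
by nra.
Qed.

Lemma in_K1_isolated_bound :
  in_K 1 (stabmx R (dunion H (edgeless m))) -> (m * a.-1 <= 4 * a)%N.
Proof.
move=> /(univariate_sos alphaH detH i0 (leqnn _)) [s [/sum_coef_sqr_cubic[S13]]].
rewrite /= => + sE; rewrite sE expr1.
have -> : ('X ^+ 2 + m%:R) *
      ((a + m)%:R * ('X ^+ 2 * 'X ^+ 2 + m%:R) - ('X ^+ 2 + m%:R) ^+ 2) =
    (a%:R + m%:R - 1 : R)%:P * 'X ^+ 6 +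
    (m%:R * (a%:R + m%:R - 1) - 2 * m%:R)%:P * 'X ^+ 4 +
    (m%:R * a%:R - 2 * (m%:R * m%:R))%:P * 'X ^+ 2 + (m%:R * m%:R * a%:R)%:P.
  by rewrite !(polyCD, polyCN, polyCM, polyC_natr, polyC1) /= ; ring.
rewrite !(coefD, coefCM, coefXn, coefC) /= !(mulr0, mulr1, add0r, addr0, mul0r).
have a1 : 2 <= a%:R :> R by rewrite ler_nat.
have a0 : a%:R != 0 :> R by rewrite pnatr_eq0; lia.
have -> : m%:R * a%:R - 2 * (m%:R * m%:R) + 2 * (m%:R * m%:R * a%:R) / a%:R =
    m%:R * a%:R :> R by field.
move=> [cs e4]; rewrite leqNgt; apply/negP => gt_bound.
have m_gt0 : 0 < m%:R :> R by rewrite ltr0n; case: m gt_bound => //.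
have gt_boundR : 4 * a%:R < m%:R * (a%:R - 1) :> R.
  have <- : a.-1%:R = a%:R - 1 :> R by rewrite -subn1 natrB // ltnW.
  by rewrite -!natrM ltr_nat.
set A : R := a%:R in a1 a0 cs e4 gt_boundR *; set M : R := m%:R in cs e4 m_gt0 gt_boundR *.
(* The relation in degree 4, solved for [S13]. *)
have eS : 2 * A * S13 = M * (A * (A + M - 1) - 2 * A - M).
  have SE : 2 * A * S13 = 2 * S13 * A + M * M * A / A ^+ 2 * A - M * M by field.
  by rewrite SE -mulrDl -e4; ring.
have : M * (A * (A + M - 1) - 2 * A - M) ^+ 2 <= 4 * A ^+ 3 * (A + M - 1).
  rewrite -(ler_pM2l m_gt0).
  have -> : M * (M * (A * (A + M - 1) - 2 * A - M) ^+ 2) = (2 * A) ^+ 2 * S13 ^+ 2.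
    by rewrite -exprMn eS; ring.
  have -> : M * (4 * A ^+ 3 * (A + M - 1)) = (2 * A) ^+ 2 * ((A + M - 1) * (M * A)) by ring.
  by rewrite ler_wpM2l // sqr_ge0.
rewrite -subr_le0.
(* The factorization isolates [M * (A - 1) - 4 * A], positive by assumption, while Cauchy-Schwarz
   makes the product nonpositive. *)
have -> : M * (A * (A + M - 1) - 2 * A - M) ^+ 2 - 4 * A ^+ 3 * (A + M - 1) =
    (A - 1) * (M * (A - 1) - 4 * A) * (M + A) ^+ 2 by ring.
apply/negP; rewrite -ltNge !mulr_gt0 ?exprn_gt0 ?subr_gt0 //; lra.
Qed.

End Endgame.

(** * From membership in the cones to the rank *)

Lemma theta_rank_eq1 (R : realType) N (G : graph N) :
  ~ in_K 0 (stabmx R G) ->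
  (theta_rank R G = Some 1%N <-> in_K 1 (stabmx R G)).
Proof.
move=> K0; rewrite /theta_rank; case: pselect => [ex|nex]; last first.
  by split=> // K1; case: nex; exists 1%N; apply/asboolP.
case: ex_minnP => r /asboolP Kr rmin; split=> [[<-]//|/asboolP/rmin].
by case: r Kr {rmin} => [|[]].
Qed.

(** The vertex set has the form [N.+1] so that [ord0] provides an axis for the obstruction. *)
Lemma theta_rank_dunion_edgeless (R : realType) N m k (H : graph N.+1)
    (c : 'I_N.+1 -> 'I_N.+1 -> 'I_k) :
  nonneighbours_clique_cover H c -> alpha H = k.+1 -> (0 < k)%N ->
  stable_sets_determine R H k.+1 ->
  (theta_rank R (dunion H (edgeless m)) = Some 1%N <-> (m * k <= 4 * k.+1)%N).
Proof.
move=> cov alphaH k0 detH.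
apply: iff_trans (theta_rank_eq1 (not_in_K0_dunion_edgeless alphaH detH _ ord0)) _ => //.
split; first exact: (in_K1_isolated_bound alphaH detH _ ord0).
exact: (in_K1_dunion_edgeless R cov).
Qed.

Theorem corollary6p14 (R : realType) (n m : nat) (hn : (2 <= n)%N) :
  (theta_rank R (dunion (cycle_graph (2 * n + 1)%N) (edgeless m)) = Some 1%N <->
     (m%:R : R) <= 4 + 4 / (n%:R - 1)) /\
  (theta_rank R (dunion (compl_graph (cycle_graph (2 * n + 1)%N)) (edgeless m))
     = Some 1%N <->
     (m <= 8)%N).
Proof.
(* With [n = k + 2], the cycle has stability number [n] and covers by [n - 1] cliques, giving
   [m (n - 1) <= 4 n]; the complement has stability number 2 and one clique, giving [m <= 8]. *)
case: n hn => [|[|k]] // _; rewrite addn1.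
have cyc := theta_rank_dunion_edgeless m (@cycle_clique_cover k)
  (alpha_cycle k) (ltn0Sn k) (@cycle_stable_determine R k).
have co := theta_rank_dunion_edgeless m (@co_cycle_clique_cover k)
  (alpha_co_cycle k) (ltn0Sn 0) (@co_cycle_stable_determine R k).
split; last by apply: iff_trans co _; rewrite muln1.
apply: iff_trans cyc _.
have k_gt0 : 0 < k.+1%:R :> R by rewrite ltr0n.
have -> : k.+2%:R - 1 = k.+1%:R :> R by rewrite -natr1 addrK.
have -> : 4 + 4 / k.+1%:R = 4 * k.+2%:R / k.+1%:R :> R.
  by rewrite -[k.+2]addn1 natrD mulrDr mulrDl mulfK ?mulr1 // gt_eqF.
by rewrite ler_pdivlMr // -!natrM ler_nat.
Qed.
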